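(* Let $G$ be a finite non-abelian group with an abelian subgroup $H$ of index $2$, and let $S\subseteq G\setminus\{1_G\}$ be inverse-closed. If $S$ is closed under conjugation in $G$, then $\mathrm{Cay}(G,S)$ is a Cayley graph of an abelian group.
   Context: For a group $G$ and an inverse-closed subset $S\subseteq G\setminus\{1_G\}$, $\mathrm{Cay}(G,S)$ is the graph with vertex set $G$ in which $g\sim h$ if and only if $hg^{-1}\in S$. A graph $X$ is a Cayley graph of a group $K$ if $X\cong\mathrm{Cay}(K,S')$ for some inverse-closed $S'\subseteq K\setminus\{1_K\}$. *)

(* Defs.v *)
From HB Require Import structures.
From mathcomp Require Import all_boot all_fingroup.

Set Implicit Arguments.
Unset Strict Implicit.
Unset Printing Implicit Defensive.

Local Open Scope group_scope.

(* A group G is given as a finGroupType gT, so that gT is also the vertex set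
   of its Cayley graphs. A graph is an adjacency relation on a finType. *)

Definition inverse_closed (gT : finGroupType) (S : {set gT}) : Prop :=
  forall x, x \in S -> x^-1 \in S.

Definition conjugation_closed (gT : finGroupType) (S : {set gT}) : Prop :=
  forall x g, x \in S -> x ^ g \in S.

Definition connection_set (gT : finGroupType) (S : {set gT}) : Prop :=
  1 \notin S /\ inverse_closed S.

Definition Cay (gT : finGroupType) (S : {set gT}) : rel gT :=
  fun g h => h * g^-1 \in S.

Definition graph_isomorphic (V W : finType) (e : rel V) (f : rel W) : Prop :=
  exists2 phi : V -> W, bijective phi & forall x y, f (phi x) (phi y) = e x y.

Definition is_Cayley_graph_of (V : finType) (e : rel V) (kT : finGroupType)
    : Prop :=
  exists2 S' : {set kT}, connection_set S' & graph_isomorphic e (Cay S').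

Lemma Cay_irreflexive (gT : finGroupType) (S : {set gT}) :
  connection_set S -> irreflexive (Cay S).
Proof. by case=> /negbTE S1 _ g; rewrite /Cay mulgV. Qed.

Lemma Cay_symmetric (gT : finGroupType) (S : {set gT}) :
  connection_set S -> symmetric (Cay S).
Proof.
case=> _ SV g h; apply/idP/idP => /SV; by rewrite /Cay invMg invgK.
Qed.

(* Main.v *)
Require Import Defs.
From HB Require Import structures.
From mathcomp Require Import all_boot all_fingroup.

Set Implicit Arguments.
Unset Strict Implicit.
Unset Printing Implicit Defensive.

Local Open Scope group_scope.

(* Fix t outside H. Since H is abelian of index 2, t^2 is central, and
   g o h := g * h ^ a(g), with a(g) = 1 on H and a(g) = t off H, is an abelian
   group law on the set G: writing elements as x t^i with x in H, it reads
   (x t^i) o (y t^j) = x y t^(i + j). The quotient of h by g for this law is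
   always conjugate in G to h g^-1, so for a conjugation-closed S the identity
   map is an isomorphism between the Cayley graphs of the two groups. *)

Definition twist (gT : finGroupType) (H : {set gT}) (t g : gT) : gT :=
  if g \in H then 1 else t.

Definition twist_mul (gT : finGroupType) (H : {set gT}) (t g h : gT) : gT :=
  g * h ^ twist H t g.

(** Conjugation by [t] and by [t^-1] will agree, [t * t] being central; the exponent is inverted so
    that it cancels against the outer twist in a quotient of two elements off [H]. *)
Definition twist_inv (gT : finGroupType) (H : {set gT}) (t g : gT) : gT :=
  g^-1 ^ (twist H t g)^-1.

(* An alias of the carrier hides its original group structure, so that the
   twisted one can be put on the same finite type. *)
Definition twist_group (gT : finGroupType) (H : {set gT}) (t : gT) : Type := gT.

HB.instance Definition _ (gT : finGroupType) (H : {set gT}) (t : gT) :=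
  Finite.copy (twist_group H t) gT.

Lemma index2_memM (gT : finGroupType) (H : {group gT}) (x y : gT) :
  #|[set: gT] : H| = 2%N -> (x * y \in H) = ((x \in H) == (y \in H)).
Proof.
move=> iH; have [Hx | Hx] := boolP (x \in H); first by rewrite groupMl.
have [Hy | Hy] := boolP (y \in H); first by rewrite groupMr // (negbTE Hx).
have: x \in [set: gT] :\: H by rewrite !inE Hx.
rewrite -(rcoset_index2 (subsetT H) iH (x := y^-1)) ?inE ?groupV ?Hy //.
by rewrite mem_rcoset invgK.
Qed.

(** The square lies in the abelian [H], so it commutes with [H] and with [t], which together
    generate the group. *)
Lemma index2_sqr_central (gT : finGroupType) (H : {group gT}) (t g : gT) :
    abelian H -> #|[set: gT] : H| = 2%N -> t \notin H ->
  commute g (t * t).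
Proof.
move=> cHH iH Ht.
have Htt : t * t \in H by rewrite index2_memM // eqxx.
have cH x : x \in H -> commute x (t * t) by move=> Hx; apply: (centsP cHH).
have ctt : commute t (t * t) by apply: commuteM.
have [/cH // | Hg] := boolP (g \in H).
rewrite -(mulgKV t g); apply/commute_sym/commuteM; apply: commute_sym => //.
by apply: cH; rewrite index2_memM // groupV (negbTE Hg) (negbTE Ht).
Qed.

Lemma index2_memJ (gT : finGroupType) (H : {group gT}) (x y : gT) :
  #|[set: gT] : H| = 2%N -> (x ^ y \in H) = (x \in H).
Proof.
move=> iH; apply: memJ_norm.
exact: (subsetP (normal_norm (index2_normal (subsetT H) iH))).
Qed.

(** The factor [y * t^-1] of [y] lies in [H] and so centralizes [x]: conjugation on [H] depends only
    on the coset. *)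
Lemma index2_conj_eq (gT : finGroupType) (H : {group gT}) (t x y : gT) :
    abelian H -> #|[set: gT] : H| = 2%N -> x \in H -> t \notin H ->
    y \notin H ->
  x ^ t = x ^ y.
Proof.
move=> cHH iH Hx Ht Hy.
have Hyt : y * t^-1 \in H.
  by rewrite index2_memM // groupV (negbTE Hy) (negbTE Ht).
rewrite -(mulgKV t y) conjgM; congr (_ ^ t).
by apply/esym/conjg_fixP/commgP; apply: (centsP cHH).
Qed.

(** The twist is multiplicative up to the central [t * t], which appears only when [x] and [y] are
    both off [H]. *)
Lemma twist_mulA (gT : finGroupType) (H : {group gT}) (t : gT) :
    abelian H -> #|[set: gT] : H| = 2%N -> t \notin H ->
  associative (twist_mul H t).
Proof.
move=> cHH iH Ht x y z; rewrite /twist_mul conjMg -conjgM mulgA.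
congr (_ * _); rewrite /twist index2_memM // index2_memJ //.
case: (x \in H); case: (y \in H); rewrite /= ?mulg1 ?mul1g //.
by rewrite conjg1; apply/conjg_fixP/commgP; apply: index2_sqr_central cHH _ _.
Qed.

Lemma twist_mul1g (gT : finGroupType) (H : {group gT}) (t : gT) :
  left_id 1 (twist_mul H t).
Proof. by move=> x; rewrite /twist_mul /twist group1 mul1g conjg1. Qed.

Lemma twist_mulVg (gT : finGroupType) (H : {group gT}) (t : gT) :
    abelian H -> #|[set: gT] : H| = 2%N -> t \notin H ->
  left_inverse 1 (twist_inv H t) (twist_mul H t).
Proof.
move=> cHH iH Ht x; rewrite /twist_mul /twist_inv {2}/twist index2_memJ // groupV.
(* Conjugating by the twist leaves [x^-1] times a conjugate of [x] by the squared twist, which is 1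
   or [t * t], hence central. *)
rewrite -/(twist H t x); apply: (conjg_inj (twist H t x)).
rewrite conjMg conjgKV conj1g -conjgM.
suff -> : x ^ (twist H t x * twist H t x) = x by rewrite mulVg.
rewrite /twist; case: (x \in H); first by rewrite mulg1 conjg1.
by apply/conjg_fixP/commgP; apply: index2_sqr_central cHH _ _.
Qed.

Lemma twist_mulC (gT : finGroupType) (H : {group gT}) (t : gT) :
    abelian H -> #|[set: gT] : H| = 2%N -> t \notin H ->
  commutative (twist_mul H t).
Proof.
move=> cHH iH Ht.
have mixed x y : x \in H -> y \notin H -> x * y = y * x ^ t.
  by move=> Hx Hy; rewrite conjgC (index2_conj_eq cHH iH Hx Ht Hy).
move=> x y; rewrite /twist_mul /twist.
have [Hx | Hx] := ifPn; have [Hy | Hy] := ifPn; rewrite ?conjg1.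
- exact: (centsP cHH).
- exact: mixed.
- by rewrite -mixed.
have HVt z : z \notin H -> z * t^-1 \in H.
  by move=> Hz; rewrite index2_memM // groupV (negbTE Hz) (negbTE Ht).
(* Right multiplication by [t * t] turns [(x * t^-1) * (y * t^-1)] into [x * y ^ t], and likewise
   with [x] and [y] exchanged. *)
have := centsP cHH _ (HVt x Hx) _ (HVt y Hy) => /(congr1 (fun z => z * (t * t))).
by rewrite !conjgE !mulgA !mulgKV.
Qed.

Lemma twist_div_conj (gT : finGroupType) (H : {group gT}) (t g h : gT) :
    abelian H -> #|[set: gT] : H| = 2%N -> t \notin H ->
  exists k, twist_mul H t h (twist_inv H t g) = (h * g^-1) ^ k.
Proof.
move=> cHH iH Ht; rewrite /twist_mul /twist_inv /twist.
have [Hh | Hh] := boolP (h \in H); have [Hg | Hg] := boolP (g \in H).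
- by exists 1; rewrite invg1 !conjg1.
(* Conjugation by [g] carries [h * g^-1] to [g^-1 * h]; the extra [t^-1] matches the exponent in
   [twist_inv]. *)
- exists (g * t^-1); rewrite conjg1 conjgM; apply: (conjg_inj t).
  rewrite conjMg !conjgKV (index2_conj_eq cHH iH Hh Ht Hg).
  by rewrite !conjgE !mulgA mulgKV mulgK.
- exists g; rewrite invg1 conjg1. rewrite (@index2_conj_eq _ H t _ h) ?groupV //.
  by rewrite -conjgC conjgE !mulgA mulgKV.
- by exists 1; rewrite conjgKV conjg1.
Qed.

Theorem lemma5p2 (gT : finGroupType) (H : {group gT}) (S : {set gT})
    (G_nonabelian : ~~ abelian [set: gT])
    (H_abelian : abelian H)
    (H_index2 : #|[set: gT] : H| = 2%N)
    (S_conn : connection_set S)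
    (S_conj : conjugation_closed S) :
  exists kT : finGroupType,
    abelian [set: kT] /\ is_Cayley_graph_of (Cay S) kT.
Proof.
have [t Ht] : exists t, t \notin H.
  apply/existsP; apply: contraNT G_nonabelian => /existsPn inH.
  by apply: abelianS H_abelian; apply/subsetP=> x _; apply: negbNE (inH x).
pose KM := Finite_isGroup.Build (twist_group H t)
  (twist_mulA H_abelian H_index2 Ht) (@twist_mul1g _ H t)
  (twist_mulVg H_abelian H_index2 Ht).
pose kT : finGroupType := HB.pack (twist_group H t) KM.
have S_conjE x g : (x ^ g \in S) = (x \in S).
  by apply/idP/idP => [/S_conj-/(_ g^-1) | /S_conj //]; rewrite conjgK.
exists kT; split.
  apply/centsP=> x _ y _; exact: (twist_mulC H_abelian H_index2 Ht).
case: S_conn => S1 SV; exists (S : {set kT}); first split.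
- exact: S1.
(* Inversion in [kT] is [twist_inv], a conjugate of the original inverse. *)
- by move=> x /SV Sx; apply: S_conj.
exists id => [|g h]; first by exists id.
rewrite /Cay /=.
have [k e] := twist_div_conj g h H_abelian H_index2 Ht.
by rewrite -(S_conjE (h * g^-1) k) -e.
Qed.
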